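(* Let $m \ge 1$ be odd and $n \ge 4$ be even. The honeycomb toroidal graph $\mathrm{HTG}(m,n,3)$ is 2-spanning cyclable if and only if one of the following holds: (i) $m=1$, $n \equiv 0 \pmod 4$ and $n > 6$; (ii) $m \geq 5$ and $n = 6$; (iii) $m \geq 3$ and $n \geq 8$.
   Context: For integers $m\ge 1$, $\ell\ge 0$ and $n\ge 4$ with $n$ even and $m-\ell$ even, the honeycomb toroidal graph $\mathrm{HTG}(m,n,\ell)$ is the simple graph with vertex set $\{u_{i,j}: 0\le i\le m-1,\ 0\le j\le n-1\}$ (first subscript computed modulo $m$, second modulo $n$) whose edge set is the set of the following unordered pairs: $\{u_{i,j},u_{i,j+1}\}$ for all $i,j$ (vertical edges); $\{u_{i,j},u_{i+1,j}\}$ for all $0\le i\le m-2$ with $i+j$ odd (flat edges); and $\{u_{m-1,j},u_{0,j+\ell}\}$ for all $j$ having the same parity as $m$ (and $\ell$) (jump edges). (Repeated pairs give a single edge.) A 2-factor of a graph is a spanning subgraph in which every vertex has valency 2. A graph $X$ is 2-spanning cyclable if for every pair of distinct vertices $u,v$ of $X$ there is a 2-factor of $X$ consisting of exactly two cycles such that $u$ and $v$ lie in different cycles. *)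

(* Defs.v *)
From mathcomp Require Import all_boot.

Set Implicit Arguments.
Unset Strict Implicit.
Unset Printing Implicit Defensive.

(* One orientation of each generating pair. The bound i <= m - 2 of the flat
   edges is forced by y.1 = x.1 + 1 with y.1 : 'I_m, so there is no wrap-around
   there. *)
Definition vertical_arc (m n : nat) (x y : 'I_m * 'I_n) : bool :=
  (x.1 == y.1) && (y.2 == x.2.+1 %% n :> nat).

Definition flat_arc (m n : nat) (x y : 'I_m * 'I_n) : bool :=
  [&& y.1 == x.1.+1 :> nat, y.2 == x.2 & odd (x.1 + x.2)].

Definition jump_arc (m n l : nat) (x y : 'I_m * 'I_n) : bool :=
  [&& x.1 == m.-1 :> nat, y.1 == 0 :> nat, y.2 == (x.2 + l) %% n :> nat
    & odd x.2 == odd m].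

Definition HTG_arc (m n l : nat) (x y : 'I_m * 'I_n) : bool :=
  [|| vertical_arc x y, flat_arc x y | jump_arc l x y].

(* (i, j) stands for u_{i,j}. Intended for 0 < m, 3 < n, n even and
   m - l even. The conjunct x != y discards the degenerate "jumps" from a vertex
   to itself (possible only when m = 1 and n divides l). *)
Definition HTG (m n l : nat) : rel ('I_m * 'I_n) :=
  fun x y => (x != y) && (HTG_arc l x y || HTG_arc l y x).

Lemma HTG_irrefl (m n l : nat) : irreflexive (@HTG m n l).
Proof. by move=> x; rewrite /HTG eqxx. Qed.

Lemma HTG_sym (m n l : nat) : symmetric (@HTG m n l).
Proof. by move=> x y; rewrite /HTG eq_sym orbC. Qed.

(* A spanning subgraph of the graph e is given by its adjacency relation f. *)
Definition two_factor (V : finType) (e f : rel V) : Prop :=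
  [/\ symmetric f, subrel f e & forall x : V, #|f x| = 2].

(* A cycle is listed by its vertices in cyclic order, without repetition. *)
Definition is_cycle (V : finType) (e : rel V) (c : seq V) : Prop :=
  ucycle e c /\ 2 < size c.

Definition cycle_edge (V : finType) (c : seq V) : rel V :=
  fun x y => [&& x \in c, y \in c & (y == next c x) || (x == next c y)].

Definition consists_of_two_cycles (V : finType) (f : rel V) (c1 c2 : seq V)
    : Prop :=
  [/\ is_cycle f c1, is_cycle f c2, [disjoint c1 & c2]
    & f =2 [rel x y | cycle_edge c1 x y || cycle_edge c2 x y]].

Definition two_spanning_cyclable (V : finType) (e : rel V) : Prop :=
  forall u v : V, u != v ->
  exists (f : rel V) (c1 c2 : seq V),
    [/\ two_factor e f, consists_of_two_cycles f c1 c2, u \in c1 & v \in c2].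

(* Main.v *)
Require Import Defs.
From mathcomp Require Import all_boot.
From mathcomp Require Import zify ring.

(** HTG(m, n, l) is the quotient of the planar honeycomb by the lattice spanned
    by (0, n) and (m, -l); the translations of the honeycomb act on it.

    If some hexagon has a Hamiltonian complement, then every translate of it has
    one, and for any u <> v some translate contains u but not v. The hexagon in
    columns 0 and 1 leaves one vertical path in each of these columns; two
    disjoint strands through columns 2, ..., m - 1 join them into a cycle as
    soon as the net vertical drift of the strands is -l modulo n. The drift can
    be any sum of m - 2 signs, which suffices for l = 3 and m >= 5. For m = 3
    one first exchanges two of the three zigzag directions of the honeycomb,
    which turns HTG(3, 2k, 3) into HTG(k, 6, 5k).

    HTG(1, n, 3) is a prism or a Moebius ladder, according to the parity of n/2.
    In the negative cases two adjacent vertices cannot be separated. *)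

Set Implicit Arguments.
Unset Strict Implicit.
Unset Printing Implicit Defensive.

(** * Separating two vertices *)

Definition separable (V : finType) (e : rel V) (u v : V) : Prop :=
  exists (f : rel V) (c1 c2 : seq V),
    [/\ two_factor e f, consists_of_two_cycles f c1 c2, u \in c1 & v \in c2].

Lemma cycle_edge_sym (V : finType) (c : seq V) : symmetric (cycle_edge c).
Proof. by move=> x y; rewrite /cycle_edge andbCA [_ || _]orbC. Qed.

Lemma cycle_edgeE (V : finType) (c : seq V) x : uniq c -> x \in c ->
  cycle_edge c x =i [:: next c x; prev c x].
Proof.
move=> Uc xc y; rewrite !inE /in_mem /= /cycle_edge xc /=.
apply/andP/orP => [[yc /orP[/eqP->|/eqP->]]|[/eqP->|/eqP->]].
- by left.
- by right; rewrite prev_next.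
- by rewrite mem_next xc eqxx.
by rewrite mem_prev xc next_prev // eqxx orbT.
Qed.

Lemma next_neq_prev (V : finType) (c : seq V) x :
  uniq c -> 2 < size c -> x \in c -> next c x != prev c x.
Proof.
move=> Uc sc xc; apply/eqP => E.
have : next c (next c x) = x by rewrite E next_prev.
case/rot_to: xc => i c' Ec; have Uc' : uniq (x :: c') by rewrite -Ec rot_uniq.
rewrite -!(next_rot i Uc) Ec.
have : 2 < size (x :: c') by rewrite -Ec size_rot.
case: c' Uc' {Ec} => [|y [|z c']] //=.
rewrite !inE !negb_or => /andP[/and3P[xy xz _]] _ _.
rewrite eqxx eq_sym (negPf xy) eqxx => Ez.
by rewrite Ez eqxx in xz.
Qed.

Lemma cycle_edge_sub (V : finType) (e : rel V) (c : seq V) :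
  symmetric e -> cycle e c -> subrel (cycle_edge c) e.
Proof.
move=> es ec x y /and3P[xc yc /orP[]/eqP->]; first exact: next_cycle.
by rewrite es; apply: next_cycle.
Qed.

Lemma separable_cycles (V : finType) (e : rel V) (c1 c2 : seq V) (u v : V) :
  symmetric e -> is_cycle e c1 -> is_cycle e c2 -> [disjoint c1 & c2] ->
  (forall x, (x \in c1) || (x \in c2)) ->
  u \in c1 -> v \in c2 -> separable e u v.
Proof.
move=> es [/andP[ec1 U1] s1] [/andP[ec2 U2] s2] dis cov uc vc.
pose f : rel V := [rel x y | cycle_edge c1 x y || cycle_edge c2 x y].
have cycf c : uniq c -> 2 < size c -> subrel (cycle_edge c) f -> is_cycle f c.
  move=> Uc sc sub; split=> //; rewrite /ucycle Uc andbT.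
  apply: cycle_from_next => // x xc; apply: sub.
  by rewrite /cycle_edge mem_next xc eqxx.
exists f, c1, c2; split=> //; last first.
  by split=> //; apply: cycf => // x y /=; rewrite /f /= => ->; rewrite ?orbT.
split.
- by move=> x y; rewrite /f /= !(cycle_edge_sym _ x).
- by move=> x y /orP[]; apply: cycle_edge_sub.
have deg (c c' : seq V) x : uniq c -> 2 < size c -> x \in c -> x \notin c' ->
    #|[pred y | cycle_edge c x y || cycle_edge c' x y]| = 2.
  move=> Uc sc xc xc'.
  have -> : 2 = #|[:: next c x; prev c x]|.
    by apply/esym/card_uniqP; rewrite /= inE next_neq_prev.
  apply: eq_card => y; rewrite -cycle_edgeE // inE /in_mem /=.
  by rewrite {2}/cycle_edge (negPf xc') orbF.
move=> x; case/orP: (cov x) => xc.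
  by apply: deg; rewrite // (disjointFr dis xc).
rewrite -[RHS](deg c2 c1 x) // ?(disjointFl dis xc) //.
by apply: eq_card => y; rewrite !inE /in_mem /= orbC.
Qed.

Section TwoFactor.
Variables (V : finType) (e f : rel V) (c1 c2 : seq V).
Hypothesis f2 : two_factor e f.
Hypothesis fc : consists_of_two_cycles f c1 c2.

Lemma two_cycles_cover x : (x \in c1) || (x \in c2).
Proof.
case: f2 fc => _ _ deg [_ _ _ ef].
have /card_gt0P[y] : 0 < #|f x| by rewrite deg.
rewrite -[y \in f x]/(f x y) ef /= /cycle_edge.
by case/orP=> /andP[-> _]; rewrite ?orbT.
Qed.

Lemma two_cycles_mono x y : f x y -> (x \in c1) = (y \in c1).
Proof.
case: fc => _ _ dis ->; rewrite /= /cycle_edge => /orP[] /and3P[xc yc _].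
  by rewrite xc yc.
by rewrite !(disjointFl dis).
Qed.

Lemma two_factor_pair x a b :
  (forall y, f x y -> y \in [:: a; b]) -> f x a /\ f x b.
Proof.
case: f2 => _ _ /(_ x) deg sub; apply/andP/contraT => nab.
have : f x \subset pred1 (if f x a then a else b).
  apply/subsetP => y fxy; have := sub _ fxy; move: fxy.
  rewrite !inE /in_mem /= => fxy /orP[]/eqP Ey; move: fxy; rewrite Ey.
    by move=> ->.
  by move=> fb; move: nab; rewrite fb andbT => /negPf->.
by move/subset_leq_card; rewrite deg card1.
Qed.

Lemma two_factor_third x a b y :
  a != b -> f x a -> f x b -> f x y -> y \in [:: a; b].
Proof.
move=> ab fa fb fy; apply: contraT => ny; case: f2 => _ _ /(_ x) deg.
suff : 2 < #|f x| by rewrite deg.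
have /card_uniqP /= <- : uniq [:: y; a; b].
  by move: ny; rewrite /= !inE => ->; rewrite ab.
apply: subset_leq_card; apply/subsetP => z.
by rewrite !inE -[z \in f x]/(f x z) => /or3P[]/eqP->.
Qed.

Lemma two_factor_count x a b c :
  uniq [:: a; b; c] -> (forall y, e x y -> y \in [:: a; b; c]) ->
  f x a + f x b + f x c = 2.
Proof.
move=> U sub; case: f2 => _ fe /(_ x) <-.
have -> : f x a + f x b + f x c = size [seq y <- [:: a; b; c] | f x y].
  by rewrite size_filter /= addn0 addnA.
rewrite -(card_uniqP (filter_uniq (f x) U)); apply: eq_card => y.
rewrite mem_filter -[y \in f x]/(f x y).
by case: (boolP (f x y)) => //= /fe/sub.
Qed.

End TwoFactor.

Lemma cycle_closed (V : finType) (f : rel V) (c : seq V) (S : pred V) x :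
  cycle f c -> (forall y z, f y z -> S y -> S z) -> x \in c -> S x ->
  forall y, y \in c -> S y.
Proof.
move=> fc clo xc Sx y; case/rot_to: xc => i c' Ec.
rewrite -(mem_rot i) Ec; move: fc; rewrite -(rot_cycle i) Ec /=.
suff aux s z : path f z s -> S z -> all S s.
  move=> /aux/(_ Sx); rewrite all_rcons => /andP[_ /allP aS].
  by rewrite inE => /orP[/eqP->//|/aS].
elim: s z => //= w s IH z /andP[fzw p] Sz; have Sw := clo _ _ fzw Sz.
by rewrite Sw (IH w).
Qed.

Lemma separable_cover (V : finType) (e : rel V) (c1 c2 : seq V) (u v : V) :
  symmetric e -> cycle e c1 -> cycle e c2 -> 2 < size c1 -> 2 < size c2 ->
  size c1 + size c2 = #|V| -> (forall x, (x \in c1) || (x \in c2)) ->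
  u \in c1 -> v \in c2 -> separable e u v.
Proof.
move=> es cy1 cy2 s1 s2 sz cov.
have : uniq (c1 ++ c2).
  apply: (@leq_size_uniq _ (enum V)); first exact: enum_uniq.
    by move=> x _; rewrite mem_cat.
  by rewrite size_cat sz cardE.
rewrite cat_uniq => /and3P[U1 nhas U2].
apply: separable_cycles => //; try by split=> //; apply/andP.
by rewrite disjoint_sym disjoint_has.
Qed.

Lemma separable_hom (V1 V2 : finType) (e1 : rel V1) (e2 : rel V2)
    (g : V1 -> V2) u v :
  symmetric e1 -> symmetric e2 -> injective g -> #|V1| = #|V2| ->
  (forall x y, e1 x y -> e2 (g x) (g y)) ->
  separable e1 u v -> separable e2 (g u) (g v).
Proof.
move=> s1 s2 gi cardV ge [f [c1 [c2 [f2 fc uc vc]]]].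
have [h _ gh] := inj_card_bij gi (eq_leq (esym cardV)).
have [[fs fe deg] [cy1 cy2 dis _]] := (f2, fc).
have map_cyc c : is_cycle f c -> is_cycle e2 (map g c).
  case=> /andP[fcc Uc] sc; rewrite /is_cycle size_map; split=> //.
  rewrite /ucycle map_inj_uniq // Uc andbT; case: c fcc {Uc sc} => //= x c.
  rewrite -map_rcons; elim: (rcons c x) {1 3}x => //= y s IH z /andP[fzy p].
  by rewrite ge ?fe //= IH.
apply: (@separable_cycles _ _ (map g c1) (map g c2)) => //.
- exact: map_cyc.
- exact: map_cyc.
- rewrite disjoint_has; apply/hasPn => _ /mapP[x xc ->].
  by rewrite mem_map // (disjointFr dis xc).
- by move=> x; rewrite -[x]gh !mem_map // (two_cycles_cover f2 fc).
- by rewrite mem_map.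
by rewrite mem_map.
Qed.

Lemma cycle_two_paths (T : Type) (e : rel T) x p q :
  symmetric e -> path e x p -> path e x q -> e (last x p) (last x q) ->
  cycle e (x :: p ++ rev q).
Proof.
move=> es pp pq epq; rewrite /= rcons_cat cat_path pp /= -rev_cons.
rewrite -(belast_rcons x q (last x p)) -{1}(last_rcons x q (last x p)) rev_path.
by rewrite (eq_path (e' := e)) ?rcons_path ?pq 1?es // => y z; rewrite es.
Qed.

(** * The universal cover *)

Section Cover.
Variables (m n l : nat).
Hypotheses (m_gt0 : 0 < m) (n_gt0 : 0 < n).

(* The projection from the planar honeycomb, restricted to its first quadrant;
   for x < m and y < n it is u_{x,y}. *)
Definition vtx (x y : nat) : 'I_m * 'I_n :=
  (Ordinal (ltn_pmod x m_gt0), Ordinal (ltn_pmod (y + l * (x %/ m)) n_gt0)).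

Lemma vtxK (u : 'I_m * 'I_n) : vtx u.1 u.2 = u.
Proof.
case: u => i j; congr pair; apply: val_inj => /=; first by rewrite modn_small.
by rewrite divn_small // muln0 addn0 modn_small.
Qed.

Lemma vtx_eqr x y y' : y = y' %[mod n] -> vtx x y = vtx x y'.
Proof.
by move=> E; congr pair; apply: val_inj => /=; rewrite -modnDml E modnDml.
Qed.

Lemma vtxDn x y : vtx x (y + n) = vtx x y.
Proof. by apply: vtx_eqr; rewrite modnDr. Qed.

Lemma vtxDm x y : vtx (x + m) y = vtx x (y + l).
Proof.
congr pair; apply: val_inj => /=; first by rewrite modnDr.
by rewrite divnDr ?dvdnn // divnn m_gt0 mulnDr muln1 addnAC addnA.
Qed.

Lemma vtxDMn k x y : vtx x (y + k * n) = vtx x y.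
Proof. by apply: vtx_eqr; rewrite addnC modnMDl. Qed.

Lemma vtxDMm k x y : vtx (x + k * m) y = vtx x (y + k * l).
Proof.
elim: k y => [|k IH] y; first by rewrite !addn0.
by rewrite !mulSn addnA addnAC vtxDm IH addnA.
Qed.

Lemma vtxDMmn k x y : vtx (x + k * n * m) y = vtx x y.
Proof. by rewrite vtxDMm mulnAC vtxDMn. Qed.

Lemma vtx_eqE x y x' y' : x < m -> x' < m -> y < n -> y' < n ->
  (vtx x y == vtx x' y') = (x == x') && (y == y').
Proof.
move=> xm x'm yn y'n; rewrite xpair_eqE.
have eqO k (a b : 'I_k) : (a == b) = (a == b :> nat) by [].
by rewrite !eqO /= !divn_small // muln0 !addn0 !modn_small.
Qed.

Lemma vtx_trans a b x y u : u = vtx x y ->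
  vtx (u.1 + a) (u.2 + b) = vtx (x + a) (y + b).
Proof.
move=> ->; rewrite [in RHS](divn_eq x m) -addnA [_ * m + _]addnC vtxDMm /=.
by apply: vtx_eqr; rewrite modnDml; congr (_ %% n); lia.
Qed.

Definition shift a b (u : 'I_m * 'I_n) := vtx (u.1 + a) (u.2 + b).

Lemma shiftE a b x y : shift a b (vtx x y) = vtx (x + a) (y + b).
Proof. exact: vtx_trans. Qed.

Lemma shiftK a b : cancel (shift a b) (shift ((n * m).-1 * a) ((n * m).-1 * b)).
Proof.
move=> u; rewrite -[u in LHS]vtxK !shiftE -!addnA -!mulSn.
rewrite prednK ?muln_gt0 ?m_gt0 ?n_gt0 //.
by rewrite mulnAC [n * a]mulnC vtxDMmn -mulnA mulnC vtxDMn vtxK.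
Qed.

Lemma shift_inj a b : injective (shift a b).
Proof. exact: can_inj (shiftK a b). Qed.

Hypotheses (n_even : ~~ odd n) (odd_ml : odd m = odd l).

Lemma odd_vtx x y : odd ((vtx x y).1 + (vtx x y).2) = odd (x + y).
Proof.
have /(congr1 odd) := divn_eq (y + l * (x %/ m)) n.
have /(congr1 odd) := divn_eq x m.
rewrite /= !oddD !oddM (negPf n_even) andbF addFb odd_ml => -> <-.
by repeat match goal with |- context [odd ?z] => case: (odd z) end.
Qed.

Lemma HTG_arcE (u v : 'I_m * 'I_n) : HTG_arc l u v =
  (v == vtx u.1 u.2.+1) || odd (u.1 + u.2) && (v == vtx u.1.+1 u.2).
Proof.
case: u v => [i j] [i' j']; rewrite /HTG_arc /vertical_arc /flat_arc /jump_arc.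
have eqO k (a b : 'I_k) : (a == b) = (a == b :> nat) by [].
rewrite /vtx /= !xpair_eqE !eqO /=.
rewrite [i %/ m]divn_small // [i %% m]modn_small // muln0 addn0 eq_sym.
congr (_ || _); case: (eqVneq (i : nat) m.-1) => [Ei|ni].
  have -> : i.+1 = m by rewrite Ei prednK.
  rewrite modnn divnn m_gt0 muln1 oddD Ei.
  have -> : odd m.-1 = ~~ odd m by case: (m) m_gt0 => //= k _; rewrite negbK.
  have -> : (i' == m :> nat) = false by rewrite ltn_eqF.
  rewrite /= andbC; have -> : (~~ odd m (+) odd j) = (odd j == odd m).
    by repeat match goal with |- context [odd ?z] => case: (odd z) end.
  by rewrite -andbA [RHS]andbA [RHS]andbC.
have lt_i : i.+1 < m by have := ltn_ord i; move: ni; lia.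
rewrite /= orbF [i.+1 %% m]modn_small // [i.+1 %/ m]divn_small // muln0 addn0.
by rewrite modn_small // andbA andbC.
Qed.

Local Notation G := (@HTG m n l).

Lemma vtx_neq x y x' y' : odd (x + y) != odd (x' + y') ->
  vtx x y != vtx x' y'.
Proof. by apply: contraNneq => E; rewrite -(odd_vtx x y) E odd_vtx. Qed.

Lemma vtx_up x y : G (vtx x y) (vtx x y.+1).
Proof.
rewrite /HTG vtx_neq; last by rewrite addnS /=; case: odd.
rewrite HTG_arcE; apply/orP; left; apply/orP; left; apply/eqP.
congr pair; apply: val_inj => /=; first by rewrite modn_mod.
rewrite [x %% m %/ m]divn_small ?ltn_pmod // muln0 addn0.
by rewrite -[in RHS]addn1 modnDml addn1 addSn.
Qed.

Lemma vtx_flat x y : odd (x + y) -> G (vtx x y) (vtx x.+1 y).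
Proof.
move=> oxy; rewrite /HTG vtx_neq; last by rewrite addSn /= oxy.
rewrite HTG_arcE odd_vtx oxy; apply/orP; left; apply/orP; right; apply/eqP.
rewrite {1}(divn_eq x m) -addnS addnC vtxDMm /=.
by apply: vtx_eqr; rewrite modn_mod [_ * l]mulnC.
Qed.

Lemma vtx_left x y : vtx (x.+1 + m.-1) (y + n.-1 * l) = vtx x y.
Proof.
rewrite addSnnS prednK // vtxDm -addnA -[X in _ + X]mulSnr prednK //.
by rewrite [n * l]mulnC vtxDMn.
Qed.

Lemma HTG_adjP x y v : G (vtx x y) v ->
  [\/ v = vtx x y.+1, v = vtx x (y + n.-1)
    | v = if odd (x + y) then vtx x.+1 y
          else vtx (x + m.-1) (y + n.-1 * l)].
Proof.
case/andP=> _; rewrite !HTG_arcE => /orP[]/orP[/eqP|/andP[o /eqP]] E.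
- constructor 1; rewrite E; have := shiftE 0 1 x y.
  by rewrite /shift !addn0 !addn1.
- constructor 3; rewrite -(odd_vtx x y) o E; have := shiftE 1 0 x y.
  by rewrite /shift !addn0 !addn1.
- constructor 2; have := shiftE 0 n.-1 x y; rewrite E shiftE !addn0 => <-.
  by rewrite addSnnS prednK // vtxDn vtxK.
constructor 3; rewrite -(odd_vtx x y) E odd_vtx addSn /= o /=.
by rewrite -(shiftE _ _ x y) E shiftE vtx_left vtxK.
Qed.

Lemma vtx_hom (V : finType) (e : rel V) (g : nat -> nat -> V) :
  (forall x y, g x y = g (x %% m) ((y + l * (x %/ m)) %% n)) ->
  (forall x y, e (g x y) (g x y.+1)) ->
  (forall x y, odd (x + y) -> e (g x y) (g x.+1 y)) -> symmetric e ->
  forall u v, G u v -> e (g u.1 u.2) (g v.1 v.2).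
Proof.
move=> gper gup gflat es u v /andP[_].
have arc (u' v' : 'I_m * 'I_n) :
    HTG_arc l u' v' -> e (g u'.1 u'.2) (g v'.1 v'.2).
  rewrite HTG_arcE => /orP[/eqP->|/andP[o /eqP->]] /=; rewrite -gper.
    exact: gup.
  exact: gflat.
by case/orP=> /arc //; rewrite es.
Qed.

Lemma shift_hom a b u v : ~~ odd (a + b) -> G u v ->
  G (shift a b u) (shift a b v).
Proof.
move=> eab; apply: (vtx_hom (g := fun x y => vtx (x + a) (y + b))).
- by move=> x y; rewrite -!shiftE; congr (shift _ _ _); rewrite -[LHS]vtxK.
- by move=> x y; rewrite addSn vtx_up.
- move=> x y o; rewrite addSn; apply: vtx_flat.
  by rewrite addnACA oddD o (negPf eab).
exact: HTG_sym.
Qed.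

Lemma separable_shift a b u v : ~~ odd (a + b) ->
  separable G (shift a b u) (shift a b v) -> separable G u v.
Proof.
move=> eab sep; rewrite -[u](shiftK a b) -[v](shiftK a b).
apply: separable_hom sep => //; try exact: HTG_sym; first exact: shift_inj.
by move=> x y; apply: shift_hom; rewrite -mulnDr oddM (negPf eab) andbF.
Qed.

End Cover.

(** * Hexagons with a Hamiltonian complement *)

Section Hexagon.
Variables (m n l : nat).
Hypotheses (m_gt0 : 0 < m) (n_gt0 : 0 < n).
Hypotheses (n_even : ~~ odd n) (odd_ml : odd m = odd l).
Hypotheses (m_ge3 : 3 <= m) (n_ge6 : 6 <= n).

Local Notation G := (@HTG m n l).
Local Notation vtx := (vtx l m_gt0 n_gt0).
Local Notation shift := (shift l m_gt0 n_gt0).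
Local Notation vtxK := (@vtxK m n l m_gt0 n_gt0).

Definition hexagon :=
  [:: vtx 0 1; vtx 0 2; vtx 0 3; vtx 1 3; vtx 1 2; vtx 1 1].

Lemma hexagon_mem x y : x < m -> y < n ->
  (vtx x y \in hexagon) = (x < 2) && (0 < y < 4).
Proof.
by move=> xm yn; rewrite !inE !vtx_eqE //; lia.
Qed.

Lemma hexagon_cycle : cycle G hexagon.
Proof.
rewrite /= [G (vtx 1 1) _]HTG_sym [G (vtx 1 2) _]HTG_sym [G (vtx 1 3) _]HTG_sym.
by rewrite !vtx_up ?vtx_flat.
Qed.

Lemma hexagon_two_spanning_cyclable (s : seq ('I_m * 'I_n)) :
  cycle G s -> size s + 6 = m * n ->
  (forall x, (x \in hexagon) || (x \in s)) -> two_spanning_cyclable G.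
Proof.
move=> cs szs cov.
have s2 : 2 < size s.
  rewrite -(ltn_add2r 6) szs.
  exact: leq_trans (leq_mul m_ge3 n_ge6).
have sepH x y : x \in hexagon -> y \notin hexagon -> separable G x y.
  move=> xh yh; apply: (separable_cover _ hexagon_cycle cs) => //.
  - exact: HTG_sym.
  - by rewrite addnC szs card_prod !card_ord.
  by have := cov y; rewrite (negPf yh).
have sep_shift a b x y : ~~ odd (a + b) -> shift a b x \in hexagon ->
    shift a b y \notin hexagon -> separable G x y.
  by move=> eab xh yh; apply: (separable_shift n_even odd_ml eab); apply: sepH.
have sep0 k v : 0 < k < 3 -> v != vtx 0 k -> separable G (vtx 0 k) v.
  move=> k03 vk; have kh : vtx 0 k \in hexagon by rewrite hexagon_mem; lia.
  case: (boolP (v \in hexagon)) => [|/sepH]; last exact.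
  move: vk; rewrite -[v]vtxK; case: v => [[x xm] [y yn]] /=.
  have km : k < n by lia.
  rewrite hexagon_mem // vtx_eqE // => vk xy.
  have [xy1|ne1] := boolP [&& x == 0, y == 2 & k == 1].
    apply: (sep_shift 0 2) => //; rewrite shiftE hexagon_mem; lia.
  have [xy1|ne2] := boolP [&& x == 0, y == 1 & k == 2].
    apply: (sep_shift 1 n.-1); rewrite ?shiftE.
    - by rewrite add1n prednK.
    - have -> : k + n.-1 = 1 + n by lia.
      by rewrite vtxDn hexagon_mem; lia.
    have -> : y + n.-1 = 0 + n by lia.
    by rewrite vtxDn hexagon_mem; lia.
  apply: (sep_shift 1 1) => //; rewrite shiftE hexagon_mem; lia.
move=> u v uv.
pose k := if odd (u.1 + u.2) then 1 else 2.
pose a := n * m - u.1; pose b := n + k - u.2.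
have um := ltn_ord u.1; have un := ltn_ord u.2.
have ule : u.1 <= n * m by rewrite ltnW // (leq_trans um) // leq_pmull.
have Eu : shift a b u = vtx 0 k.
  rewrite -[u in LHS]vtxK shiftE /a /b subnKC //.
  rewrite subnKC ?(leq_trans (ltnW un)) ?leq_addr // addnC vtxDn.
  by have -> : n * m = 0 + 1 * n * m; rewrite ?vtxDMmn ?mul1n.
have eab : ~~ odd (a + b).
  have un' : u.2 <= n + k by rewrite ltnW // ltn_addr.
  rewrite oddD /a /b !oddB // oddM oddD (negPf n_even) /= /k oddD.
  by case: (odd u.1); case: (odd u.2).
apply: (separable_shift n_even odd_ml eab); rewrite Eu; apply: sep0.
  by rewrite /k; case: ifP.
by rewrite -Eu (inj_eq (@shift_inj _ _ _ _ _ _ _)) eq_sym.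
Qed.

(* Two strands run from left to right through the columns, entering a column at
   rows p and p + 4 ([up = false], [up = true]). Both leave it one row higher
   ([s = true]) or one row lower, having exchanged their roles, and together
   exhaust it. *)
Definition seg x a k := [seq vtx x y | y <- iota a k].

Definition entry p (up : bool) := if up then p + 4 else p.

Definition next_row (s : bool) p := if s then p.+1 else p + n.-1.

Definition column (s : bool) x p (up : bool) :=
  match s, up with
  | true, true => rev (seg x p.+1 4)
  | true, false => rev (seg x (p + 5) (n - 4))
  | false, true => seg x (p + 4) (n - 4)
  | false, false => seg x p 4
  end.

Fixpoint strand (eps : seq bool) x p (up : bool) :=
  if eps is s :: eps' then
    column s x p up ++ strand eps' x.+1 (next_row s p) (~~ up)
  else [::].

Lemma seg_path z x a k : G z (vtx x a) ->
  path G z (seg x a k.+1) /\ last z (seg x a k.+1) = vtx x (a + k).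
Proof.
elim: k z a => [|k IH] z a zx; first by rewrite /= zx addn0.
have [|p Ep] := IH (vtx x a) a.+1; first exact: vtx_up.
by split; [rewrite /= zx; exact: p | rewrite -addSnnS -Ep].
Qed.

Lemma rev_seg_path z x a k : G z (vtx x (a + k)) ->
  path G z (rev (seg x a k.+1)) /\ last z (rev (seg x a k.+1)) = vtx x a.
Proof.
move=> zx; rewrite [seg _ _ _]/= rev_cons last_rcons; split=> //.
elim: k z a zx => [|k IH] z a zx; first by rewrite /= -[a]addn0 zx.
rewrite rcons_path rev_cons last_rcons IH ?addSnnS //=.
by rewrite HTG_sym vtx_up.
Qed.

Lemma column_path s z x p up : ~~ odd (x + p) -> G z (vtx x (entry p up)) ->
  path G z (column s x p up) /\
  G (last z (column s x p up)) (vtx x.+1 (entry (next_row s p) (~~ up))).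
Proof.
have En : n - 4 = (n - 5).+1 by lia.
have En1 : odd n.-1 by lia.
move=> exp; case: s up => [] []; rewrite /column /entry /next_row /negb => zx.
- have [|? ->] := @rev_seg_path z x p.+1 3; first by rewrite addSnnS.
  by split=> //; apply: vtx_flat => //; lia.
- rewrite En; have [|? ->] := @rev_seg_path z x (p + 5) (n - 5).
    have -> : p + 5 + (n - 5) = p + n by lia.
    by rewrite vtxDn.
  by split=> //; rewrite addSnnS; apply: vtx_flat => //; lia.
- rewrite En; have [|? ->] := @seg_path z x (p + 4) (n - 5) => //.
  have -> : p + 4 + (n - 5) = p + n.-1 by lia.
  by split=> //; apply: vtx_flat => //; lia.
have [|? ->] := @seg_path z x p 3 => //.
have -> : p + n.-1 + 4 = p + 3 + n by lia.
by rewrite vtxDn; split=> //; apply: vtx_flat => //; lia.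
Qed.

Lemma strand_path eps z x p up : ~~ odd (x + p) -> G z (vtx x (entry p up)) ->
  path G z (strand eps x p up) /\
  G (last z (strand eps x p up))
    (vtx (x + size eps) (entry (foldl (fun p s => next_row s p) p eps)
                               (up (+) odd (size eps)))).
Proof.
elim: eps z x p up => [|s eps IH] z x p up exp zx.
  by rewrite /= addn0 addbF.
have [p1 e1] := column_path s exp zx.
have [|p2 e2] := IH _ _ _ _ _ e1; first by rewrite /next_row; case: (s); lia.
rewrite /= cat_path p1 last_cat p2; split=> //.
by move: e2; rewrite addSnnS addNb -addbN.
Qed.

Lemma size_seg x a k : size (seg x a k) = k.
Proof. by rewrite size_map size_iota. Qed.

Lemma size_strand eps x p up :
  size (strand eps x p up) + size (strand eps x p (~~ up)) = n * size eps.
Proof.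
elim: eps x p up => [|s eps IH] x p up; first by rewrite muln0.
rewrite /= !size_cat addnACA IH mulnS; congr (_ + _).
by case: s up => [] []; rewrite /= ?size_rev ?size_seg /=; lia.
Qed.

Lemma mem_seg x y a : vtx x y \in seg x a n.
Proof.
apply/mapP; exists (a + (y + a * n.-1) %% n).
  by rewrite mem_iota leq_addr ltn_add2l ltn_pmod.
apply: vtx_eqr; rewrite modnDmr addnCA -mulnS prednK //.
by rewrite addnC modnMDl.
Qed.

Lemma seg_cat x a j k : seg x a (j + k) = seg x a j ++ seg x (a + j) k.
Proof. by rewrite /seg iotaD map_cat. Qed.

Lemma mem_strand eps x p up x' y : x <= x' < x + size eps ->
  (vtx x' y \in strand eps x p up) || (vtx x' y \in strand eps x p (~~ up)).
Proof.
elim: eps x p up => [|s eps IH] x p up /=; first by lia.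
rewrite !mem_cat; case: (ltngtP x x') => //= [lt_xx'|<-] Hx'.
  have := IH x.+1 (next_row s p) (~~ up).
  by rewrite addSnnS lt_xx' Hx' => /(_ isT)/orP[]->; rewrite !orbT.
have col a : (vtx x y \in seg x a 4) || (vtx x y \in seg x (a + 4) (n - 4)).
  by rewrite -mem_cat -seg_cat subnKC ?mem_seg //; lia.
have E5 : p + 5 = p.+1 + 4 by lia.
by case: s up => [] [] /=; rewrite ?mem_rev ?E5;
   [case/orP: (col p.+1) | case/orP: (col p.+1) | case/orP: (col p)
   | case/orP: (col p)] => ->; rewrite ?orbT.
Qed.

Lemma strands_two_spanning_cyclable (eps : seq bool) :
  size eps = m - 2 ->
  foldl (fun p s => next_row s p) 0 eps + l = 0 %[mod n] ->
  two_spanning_cyclable G.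
Proof.
move=> sz_eps end_eps; set pe := foldl _ _ _ in end_eps.
pose b := odd (size eps).
pose P := strand eps 2 0 false; pose Q := strand eps 2 0 true.
pose C := if b then seg 0 4 (n - 3) else rev (seg 0 4 (n - 3)).
pose z := vtx 1 4.
have En3 : n - 3 = (n - 4).+1 by lia.
have vn x : vtx x n = vtx x 0 by apply: (vtxDn _ _ _ x 0).
have v4n x : vtx x (4 + (n - 4)) = vtx x 0 by rewrite subnKC ?vn //; lia.
have glue c : vtx (2 + size eps) (entry pe c) = vtx 0 (entry 0 c).
  have -> : 2 + size eps = 0 + m by lia.
  rewrite vtxDm; apply: vtx_eqr; rewrite /entry; case: c => //.
  by rewrite addnAC -modnDml end_eps modnDml.
have [pC1 lC1] : path G z (seg 1 5 (n - 4)) /\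
    last z (seg 1 5 (n - 4)) = vtx 1 0.
  have En4 : n - 4 = (n - 5).+1 by lia.
  rewrite En4; have [|? ->] := @seg_path z 1 5 (n - 5); first exact: vtx_up.
  by split=> //; rewrite -vn; congr vtx; lia.
have [pP eP] : path G (vtx 1 0) P /\ G (last (vtx 1 0) P) (vtx 0 (entry 0 b)).
  have [||? e] := @strand_path eps (vtx 1 0) 2 0 false => //.
    exact: vtx_flat.
  by split=> //; rewrite -glue.
have [pQ eQ] : path G z Q /\ G (last z Q) (vtx 0 (entry 0 (~~ b))).
  have [||? e] := @strand_path eps z 2 0 true => //.
    exact: vtx_flat.
  by split=> //; rewrite -glue.
have [pC lC] : path G (last (vtx 1 0) P) C /\
    last (last (vtx 1 0) P) C = vtx 0 (entry 0 (~~ b)).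
  move: eP; rewrite /C En3 /entry; case: (b) => eP.
    by have [|? ->] := @seg_path (last (vtx 1 0) P) 0 4 (n - 4).
  by have [|? ->] := @rev_seg_path (last (vtx 1 0) P) 0 4 (n - 4); rewrite ?v4n.
apply: (@hexagon_two_spanning_cyclable
         (z :: seg 1 5 (n - 4) ++ P ++ C ++ rev Q)).
- rewrite !catA; apply: cycle_two_paths => //; first exact: HTG_sym.
    by rewrite !cat_path !last_cat pC1 lC1 pP.
  by rewrite !last_cat lC1 lC HTG_sym.
- have := size_strand eps 2 0 false; rewrite -/P -/Q.
  have sC : size C = n - 3 by rewrite /C; case: ifP; rewrite ?size_rev size_seg.
  rewrite /= !size_cat size_rev size_seg sC sz_eps => sPQ.
  have : m * n = n * (m - 2) + n * 2 by rewrite -mulnDr subnK 1?mulnC // ltnW.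
  lia.
move=> u; rewrite -[u]vtxK.
move: (u.1 : nat) (u.2 : nat) (ltn_ord u.1) => x y xm.
have C4 x' : (vtx x' y \in seg x' 1 3) || (vtx x' y \in seg x' 4 (n - 3)).
  by rewrite -mem_cat -(@seg_cat _ 1) subnKC ?mem_seg // (leq_trans _ n_ge6).
rewrite -cat_cons !mem_cat mem_rev.
have -> : z :: seg 1 5 (n - 4) = seg 1 4 (n - 3) by rewrite En3.
case: x xm => [|[|x]] xm.
- have -> : (vtx 0 y \in C) = (vtx 0 y \in seg 0 4 (n - 3)).
    by rewrite /C; case: (b); rewrite ?mem_rev.
  case/orP: (C4 0) => [|->]; last by rewrite !orbT.
  by rewrite /seg /= !inE => /or3P[]->; rewrite ?orbT.
- case/orP: (C4 1) => [|->]; last by rewrite !orbT.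
  by rewrite /seg /= !inE => /or3P[]->; rewrite ?orbT.
have : 2 <= x.+2 < 2 + size eps by rewrite sz_eps subnKC // ltnW.
move=> /(@mem_strand eps 2 0 false _ y)/orP[]; rewrite -/P -/Q => ->;
by rewrite !orbT.
Qed.

End Hexagon.

(** * The positive cases *)

Lemma foldl_next_row n a b p :
  foldl (fun p s => next_row n s p) p (nseq a true ++ nseq b false)
  = p + a + b * n.-1.
Proof.
rewrite foldl_cat.
have -> : foldl (fun p s => next_row n s p) p (nseq a true) = p + a.
  by elim: a p => [|a IH] p; rewrite ?addn0 //= IH /= addnS.
elim: b (p + a) => [|b IH] q; first by rewrite addn0.
by rewrite /= IH mulSn addnA.
Qed.

Lemma HTG3_two_spanning_cyclable m n :
  odd m -> ~~ odd n -> 5 <= m -> 6 <= n -> two_spanning_cyclable (@HTG m n 3).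
Proof.
move=> om en m5 n6; have [m0 n0] : 0 < m /\ 0 < n by split; lia.
pose a := (m - 5)./2.
apply: (@strands_two_spanning_cyclable m n 3 m0 n0 en _ _ n6
         (nseq a true ++ nseq (a + 3) false)) => //.
- by apply: leq_trans m5.
- by rewrite size_cat !size_nseq /a; lia.
rewrite foldl_next_row add0n addnAC -mulnS prednK //.
by rewrite modnMl mod0n.
Qed.

Lemma surj_card_inj (T1 T2 : finType) (g : T1 -> T2) :
  #|T1| = #|T2| -> (forall y, exists x, g x = y) -> injective g.
Proof.
move=> cardT surj x y; apply: (@image_injP _ _ g T1 _) => //.
rewrite cardT; apply/eqP/eq_card => z; rewrite inE.
by have [w <-] := surj z; apply: codom_f.
Qed.

Lemma two_spanning_cyclable_hom (V1 V2 : finType) (e1 : rel V1)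
    (e2 : rel V2) (g : V1 -> V2) :
  symmetric e1 -> symmetric e2 -> #|V1| = #|V2| ->
  (forall y, exists x, g x = y) -> (forall x y, e1 x y -> e2 (g x) (g y)) ->
  two_spanning_cyclable e1 -> two_spanning_cyclable e2.
Proof.
move=> s1 s2 cardV surj ge cyc u v; have gi := surj_card_inj cardV surj.
have [[x <-] [y <-]] := (surj u, surj v); rewrite inj_eq // => /cyc.
exact: separable_hom.
Qed.

(* Since (3, -3) is a lattice vector, the zigzags in direction (1, -1) of
   HTG(3, 2k, 3) are 6-cycles; taking them as columns identifies it with
   HTG(k, 6, 5k), whose strand diagrams have enough room. *)
Lemma HTG3_3_two_spanning_cyclable n :
  ~~ odd n -> 8 <= n -> two_spanning_cyclable (@HTG 3 n 3).
Proof.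
move=> en n8; pose k := n./2; have En : n = k.*2 by lia.
have k4 : 4 <= k by lia.
have [k0 n0] : 0 < k /\ 0 < n by split; lia.
have ok : odd k = odd (5 * k) by rewrite oddM.
have k_cyc : two_spanning_cyclable (@HTG k 6 (5 * k)).
  apply: (@strands_two_spanning_cyclable k 6 _ k0 isT isT ok _ isT
           (nseq (k - 4) true ++ nseq 2 false)).
  - lia.
  - by rewrite size_cat !size_nseq; lia.
  rewrite foldl_next_row.
  have -> : 0 + (k - 4) + 2 * 5 + 5 * k = k.+1 * 6 by lia.
  by rewrite modnMl mod0n.
pose T t i := vtx 3 (isT : 0 < 3) n0 t./2 (2 + n.-1 * (uphalf t + i.*2)).
pose g x y := T (y + 5 * x) x.
have T6 t i q : T (t + q * 6) i = T t i.
  elim: q => [|q <-]; first by rewrite addn0.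
  rewrite mulSnr addnA; move: (t + _) => {}t.
  rewrite /T; have -> : (t + 6)./2 = t./2 + 3 by lia.
  rewrite vtxDm; have -> : uphalf (t + 6) = uphalf t + 3 by lia.
  rewrite -(vtxDMn _ _ _ 3 t./2 (2 + n.-1 * (uphalf t + _))).
  by congr vtx; move: n.-1 (prednK n0) => n' <-; ring.
have Tmod t t' i : t = t' %[mod 6] -> T t i = T t' i.
  by move=> E; rewrite (divn_eq t 6) (divn_eq t' 6) E ![_ * 6 + _]addnC !T6.
have Tk t i q : T t (q * k + i) = T t i.
  rewrite /T -(vtxDMn _ _ _ (n.-1 * q) t./2 (2 + n.-1 * (uphalf t + i.*2))).
  by congr vtx; move: n.-1 => N; rewrite [in RHS]En -!muln2; ring.
have gper x y : g x y = g (x %% k) ((y + 5 * k * (x %/ k)) %% 6).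
  rewrite /g {2}(divn_eq x k) Tk; apply: Tmod.
  by rewrite modnDml {1}(divn_eq x k); congr (_ %% _); ring.
have odd1 : odd n.-1 by lia.
apply: (two_spanning_cyclable_hom (g := fun u : 'I_k * 'I_6 => g u.1 u.2)
          _ _ _ _ _ k_cyc).
- exact: HTG_sym.
- exact: HTG_sym.
- by rewrite !card_prod !card_ord; lia.
- move=> u; rewrite -[u](@vtxK 3 n 3 isT n0).
  move: (u.1 : nat) (u.2 : nat) (ltn_ord u.1) (ltn_ord u.2) => x y x3 yn.
  pose b : nat := odd (x + y).
  pose i := (2 + n + n - x - y)./2.
  exists (vtx (5 * k) k0 (isT : 0 < 6) i (x.*2 + b + i)).
  rewrite /= -gper /g -addnA -mulSn [6 * i]mulnC T6 /T.
  have -> : (x.*2 + b)./2 = x by rewrite /b; lia.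
  apply: vtx_eqr.
  have -> : uphalf (x.*2 + b) + i.*2 = 2 + n + n - y by rewrite /b /i; lia.
  rewrite -(modnMDl (n + n - y) y); congr (_ %% _).
  have [d Ed] : exists d, n = y + d by exists (n - y); lia.
  have -> : 2 + n + n - y = 2 + n + d by lia.
  have -> : n + n - y = n + d by lia.
  by move: (prednK n0) Ed; move: n.-1 => n' <- Ed; nia.
have downG x y : HTG 3 (vtx 3 (isT : 0 < 3) n0 x y)
                       (vtx 3 (isT : 0 < 3) n0 x (y + n.-1)).
  rewrite HTG_sym -(vtxDn 3 (isT : 0 < 3) n0 x y).
  have -> : y + n = (y + n.-1).+1 by lia.
  exact: vtx_up.
apply: (vtx_hom k0 (isT : 0 < 6)) => //.
- move=> x y; rewrite /g /T [y.+1 + _]addSn; move: (y + _) => t.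
  have [ot|et] := boolP (odd t).
    have -> : uphalf t.+1 = uphalf t by lia.
    have -> : t.+1./2 = t./2.+1 by lia.
    by apply: vtx_flat => //; rewrite !oddD oddM odd1 oddD odd_double; lia.
  have -> : uphalf t.+1 = (uphalf t).+1 by lia.
  have -> : t.+1./2 = t./2 by lia.
  by rewrite addSn mulnS [n.-1 + _]addnC addnA.
- move=> x y oxy; rewrite /g /T.
  have -> : y + 5 * x.+1 = y + 5 * x + 5 by rewrite mulnS addnCA addnC.
  have : odd (y + 5 * x) by lia.
  move: (y + _) => t ot.
  have -> : (t + 5)./2 = t./2 + 3 by lia.
  have -> : uphalf (t + 5) = (uphalf t) + 2 by lia.
  set A := 2 + _; rewrite vtxDm.
  have -> : 2 + n.-1 * (uphalf t + 2 + x.+1.*2) + 3 = A + n.-1 + 3 * n.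
    by rewrite /A; move: n.-1 (prednK n0) => n' <-; rewrite -!muln2; ring.
  by rewrite vtxDMn.
exact: HTG_sym.
Qed.

(** * One column *)

Section Ladder.
Variables (n : nat).
Hypotheses (n_gt0 : 0 < n) (n_even : ~~ odd n).

Local Notation G := (@HTG 1 n 3).
Local Notation v := (vtx 3 (isT : 0 < 1) n_gt0 0).

Lemma ladder_jump j : odd j -> G (v j) (v (j + 3)).
Proof. by move=> oj; rewrite -vtxDm; apply: vtx_flat. Qed.

Lemma ladder_adjP j w : G (v j) w ->
  w \in [:: v j.+1; v (j + n.-1);
            if odd j then v (j + 3) else v (j + n.-1 * 3)].
Proof.
move=> /(HTG_adjP n_even (erefl : odd 1 = odd 3)).
rewrite -(vtxDm 3 _ n_gt0 0 j).
by rewrite !inE => -[] /eqP ->; rewrite ?orbT.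
Qed.

(* The edges {v (2t+1), v (2t+2)} are the rungs of a ladder with n/2 rungs; when
   n/2 is odd it is a Moebius ladder. If a 2-factor separates the ends of one
   rung, it contains all the rails, and the colours of the ends alternate along
   the ladder. *)
Lemma moebius_not_two_spanning_cyclable :
  odd n./2 -> 6 <= n -> ~ two_spanning_cyclable G.
Proof.
move=> ok n6 cyc; set k := n./2 in ok.
have [|f [c1 [c2 [f2 fc v1 v2]]]] := cyc (v 1) (v 2).
  by rewrite vtx_eqE //; lia.
have [fs fe _] := f2; have [_ _ dis _] := fc.
have mono := two_cycles_mono fc.
have colour t :
    (v (2 * t).+1 \in c1) = ~~ odd t /\ (v (2 * t).+2 \in c1) = odd t.
  elim: t => [|t [IH1 IH2]]; first by rewrite v1 (disjointFl dis v2).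
  set a := (2 * t).+1 in IH1 IH2 *.
  have nf : ~~ f (v a) (v a.+1).
    by apply/negP => /mono; rewrite IH1 IH2; case: odd.
  have -> : 2 * t.+1 = a.+1 by rewrite mulnS.
  have oa : odd a by rewrite /a /= oddM.
  rewrite -(addn3 a).
  have [_ /mono <-] : f (v a) (v (a + n.-1)) /\ f (v a) (v (a + 3)).
    apply: (two_factor_pair f2) => y fy; have := ladder_adjP (fe _ _ fy).
    rewrite oa inE => /orP[/eqP Ey|//].
    by move: fy; rewrite Ey (negPf nf).
  have [/mono <- _] : f (v a.+1) (v a.+2) /\ f (v a.+1) (v (a.+1 + n.-1 * 3)).
    apply: (two_factor_pair f2) => y fy; have := ladder_adjP (fe _ _ fy).
    have -> : odd a.+1 = false by rewrite -[odd a.+1]/(~~ odd a) oa.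
    rewrite addSnnS prednK // vtxDn !inE => /or3P[->|/eqP Ey|->] //.
      by move: fy; rewrite Ey fs (negPf nf).
    by rewrite orbT.
  by rewrite IH1 IH2 negbK.
have [] := colour k; have -> : (2 * k).+1 = 1 + n by rewrite /k; lia.
by rewrite vtxDn v1 ok.
Qed.

Fixpoint zigzag d a c :=
  if c is c'.+1 then [:: v a, v (a + d) & zigzag d (a + 4) c'] else [::].

Lemma zigzag_path z d a c : (d == 1) && ~~ odd a || (d == 3) && odd a ->
  G z (v a) ->
  path G z (zigzag d a c.+1) /\ last z (zigzag d a c.+1) = v (a + 4 * c + d).
Proof.
elim: c a z => [|c IH] a z da za; have e1 : G (v a) (v (a + d)).
- by case/orP: da => /andP[/eqP-> oa]; rewrite ?addn1 ?vtx_up ?ladder_jump.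
- by rewrite /= za e1 muln0 addn0.
- by case/orP: da => /andP[/eqP-> oa]; rewrite ?addn1 ?vtx_up ?ladder_jump.
have e2 : G (v (a + d)) (v (a + 4)).
  case/orP: da => /andP[/eqP-> oa]; last by rewrite (addnS a 3) vtx_up.
  by rewrite (addnA a 1 3) ladder_jump // addn1.
have [||p l] := IH (a + 4) (v (a + d)) => //; first by rewrite oddD addbF.
split; first by move: p; rewrite [zigzag _ _ _.+2]/= => /= ->; rewrite za e1.
by move: l; rewrite mulnS addnA => <-.
Qed.

Lemma size_zigzag d a c : size (zigzag d a c) = 2 * c.
Proof. by elim: c a => //= c IH a; rewrite IH mulnS. Qed.

Lemma mem_zigzag d a c t : t < c ->
  (v (a + 4 * t) \in zigzag d a c) && (v (a + 4 * t + d) \in zigzag d a c).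
Proof.
elim: c a t => // c IH a [|t] tc /=.
  by rewrite muln0 addn0 !inE !eqxx orbT.
have /andP[] := IH (a + 4) t tc.
by rewrite mulnS !addnA !inE => -> ->; rewrite !orbT.
Qed.

Lemma zigzag_cycle d a c : (d == 1) && ~~ odd a || (d == 3) && odd a ->
  n = 4 * c.+1 -> cycle G (zigzag d a c.+1).
Proof.
move=> da En; have cl : G (v (a + 4 * c + d)) (v a).
  have -> : v a = v (a + 4 * c + 4) by rewrite -addnA -mulnSr -En vtxDn.
  case/orP: da => /andP[/eqP-> oa].
    by rewrite (addnA _ 1 3) ladder_jump //; lia.
  by rewrite (addnS _ 3) vtx_up.
have [//|p l] := @zigzag_path (v (a + 4 * c + d)) d a c da.
by rewrite (cycle_path (v (a + 4 * c + d))) l.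
Qed.

Lemma prism_two_spanning_cyclable :
  4 %| n -> 8 <= n -> two_spanning_cyclable G.
Proof.
case/dvdnP=> q; rewrite mulnC => En n8.
have n5 : 4 < n by apply: leq_trans n8.
pose h := [:: v 1; v 2; v 3; v 4].
have hP j : 0 < j < n -> (v j \in h) = (j < 5).
  by case/andP=> j0 jn; rewrite !inE !vtx_eqE //; lia.
have [q' Eq] : exists q', q = q'.+2 by exists (q - 2); lia.
have cardV : #|{: 'I_1 * 'I_n}| = n by rewrite card_prod !card_ord mul1n.
have zz d a c t j : t < c -> (j == a + 4 * t) || (j == a + 4 * t + d) ->
    v j \in zigzag d a c.
  by move=> /(mem_zigzag d a)/andP[? ?] /orP[]/eqP->.
have vP x : exists2 j, 0 < j <= n & x = v j.
  have Ex := vtxK 3 (isT : 0 < 1) n_gt0 x; have x2 := ltn_ord x.2.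
  have x1 : x.1 = 0 :> nat by have := ltn_ord x.1; lia.
  move: Ex; rewrite x1; case: (posnP x.2) => [->|x20] Ex.
    by exists n; rewrite ?n_gt0 ?leqnn // -Ex -(vtxDn 3 _ n_gt0 0 0).
  by exists x.2; rewrite // x20 ltnW.
have s1 : 2 < 2 * q by lia.
have rail1 t : t < q ->
    v (1 + 4 * t) \in zigzag 3 1 q /\ v (4 + 4 * t) \in zigzag 3 1 q.
  by move=> tq; split; apply: (zz _ _ _ t) => //; rewrite addnAC eqxx ?orbT.
have rail2 t : t < q ->
    v (2 + 4 * t) \in zigzag 1 2 q /\ v (3 + 4 * t) \in zigzag 1 2 q.
  by move=> tq; split; apply: (zz _ _ _ t) => //; rewrite addnAC eqxx ?orbT.
have residue j : 0 < j ->
    exists2 t, [\/ j = 1 + 4 * t, j = 2 + 4 * t, j = 3 + 4 * t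
                 | j = 4 + 4 * t] & 4 * t < j.
  move=> j0; have := divn_eq (j - 1) 4; set t := _ %/ 4.
  have: (j - 1) %% 4 < 4 by rewrite ltn_pmod.
  case: (_ %% 4) => [|[|[|[|]]]] // _ Ej; exists t; try lia.
  - by constructor 1; lia.
  - by constructor 2; lia.
  - by constructor 3; lia.
  by constructor 4; lia.
have sep_rails x y : x \in zigzag 3 1 q -> y \in zigzag 1 2 q ->
    separable G x y /\ separable G y x.
  have cy1 : cycle G (zigzag 3 1 q) by rewrite Eq zigzag_cycle // -Eq.
  have cy2 : cycle G (zigzag 1 2 q) by rewrite Eq zigzag_cycle // -Eq.
  have cov z : (z \in zigzag 3 1 q) || (z \in zigzag 1 2 q).
    have [j /andP[j0 jn] ->] := vP z; have [t Et tj] := residue j j0.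
    have tq : t < q by lia.
    have [[a1 a4] [a2 a3]] := (rail1 t tq, rail2 t tq).
    by case: Et => ->; rewrite ?a1 ?a2 ?a3 ?a4 ?orbT.
  have sz : size (zigzag 3 1 q) + size (zigzag 1 2 q) = #|{: 'I_1 * 'I_n}|.
    by rewrite cardV !size_zigzag; lia.
  have [z1 z2] : 2 < size (zigzag 3 1 q) /\ 2 < size (zigzag 1 2 q).
    by rewrite !size_zigzag.
  have es := @HTG_sym 1 n 3.
  move=> xr yr; split; first exact: (separable_cover es cy1 cy2).
  apply: (separable_cover es cy2 cy1) => //; first by rewrite addnC.
  by move=> z; rewrite orbC.
pose s := zigzag 3 5 q'.+1 ++ rev (zigzag 1 6 q'.+1).
have hcyc : cycle G h by rewrite /= !vtx_up // HTG_sym (ladder_jump (j := 1)).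
have scyc : cycle G s.
  have [||/andP[_ p1] l1] := @zigzag_path (v 6) 3 5 q' => //.
    by rewrite HTG_sym vtx_up.
  have [||p2 l2] := @zigzag_path (v 5) 1 6 q' => //; first by rewrite vtx_up.
  apply: (@cycle_two_paths _ G (v 5) (v (5 + 3) :: zigzag 3 (5 + 4) q')) => //.
    exact: HTG_sym.
  rewrite l2 -[last _ _]/(last (v 6) (zigzag 3 5 q'.+1)) l1.
  by rewrite addn3 addn1 HTG_sym vtx_up.
have sep_block x y : x \in h -> y \notin h -> separable G x y.
  have cov z : (z \in h) || (z \in s).
    have [j /andP[j0 jn] ->] := vP z; have [[|t] Et tj] := residue j j0.
      by case: Et => ->; rewrite !inE eqxx ?orbT.
    have tq : t < q'.+1 by lia.
    rewrite mem_cat mem_rev.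
    case: Et => ->; rewrite orbC.
    - by rewrite (zz 3 5 _ t) ?orbT //; lia.
    - by rewrite (zz 1 6 _ t) ?orbT //; lia.
    - by rewrite (zz 1 6 _ t) ?orbT //; lia.
    by rewrite (zz 3 5 _ t) ?orbT //; lia.
  move=> xh yh; apply: (separable_cover _ hcyc scyc) => //.
  - exact: HTG_sym.
  - by rewrite size_cat size_rev !size_zigzag; lia.
  - by rewrite size_cat size_rev !size_zigzag cardV /=; lia.
  by have := cov y; rewrite (negPf yh).
have q0 : 0 < q by rewrite Eq.
have [[r1 r4] [r2 r3]] := (rail1 0 q0, rail2 0 q0).
have sepS := @separable_shift 1 n 3 (isT : 0 < 1) n_gt0 n_even erefl.
have sep0 k x : 0 < k < 3 -> x != v k -> separable G (v k) x.
  case/andP=> k0 k3 xk; have k5 := leq_trans k3 (isT : 3 <= 5).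
  have kh : v k \in h by rewrite hP // k0 (leq_trans k5).
  have [xh|] := boolP (x \in h); last exact: sep_block.
  have sep_shift j : 4 < j.+2 < n -> separable G (v k) (v j).
    move=> /andP[j4 jn]; apply: (sepS 0 2) => //.
    rewrite !shiftE !addn2; apply: sep_block; rewrite hP //=.
      exact: leq_trans n5.
    by rewrite -leqNgt.
  move: xh xk sep_shift; rewrite !inE.
  case: k k0 k3 {k5 kh} => [|[|[|k]]] // _ _.
    case/or4P => /eqP-> ne sep_shift; first by rewrite eqxx in ne.
    - exact: (sep_rails _ _ r1 r2).1.
    - exact: (sep_rails _ _ r1 r3).1.
    by apply: sep_shift; apply: leq_trans n8.
  case/or4P => /eqP-> ne sep_shift.
  - exact: (sep_rails _ _ r1 r2).2.
  - by rewrite eqxx in ne.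
  - by apply: sep_shift; apply: leq_trans n8.
  exact: (sep_rails _ _ r4 r2).2.
move=> x y; have [j /andP[j0 jn] ->] := vP x => xy.
pose k := if odd j then 1 else 2.
have jnk : j <= n + k by apply: leq_trans jn (leq_addr _ _).
have Ej : shift 3 (isT : 0 < 1) n_gt0 0 (n + k - j) (v j) = v k.
  by rewrite shiftE subnKC // addnC vtxDn.
apply: (sepS 0 (n + k - j)).
  rewrite add0n oddB // oddD (negPf n_even) /k.
  by case: (odd j).
rewrite Ej; apply: sep0; first by rewrite /k; case: ifP.
by rewrite -Ej (inj_eq (@shift_inj _ _ _ _ _ _ _)) eq_sym.
Qed.

End Ladder.

(** * The exceptional cases *)

Lemma separable_card (V : finType) (e : rel V) u v :
  separable e u v -> 6 <= #|V|.
Proof.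
case=> f [c1 [c2 [_ [[/andP[_ U1] s1] [/andP[_ U2] s2] dis _] _ _]]].
have /card_uniqP Ucat : uniq (c1 ++ c2).
  by rewrite cat_uniq U1 U2 -disjoint_has disjoint_sym dis.
apply: leq_trans (max_card (mem (c1 ++ c2))).
by rewrite Ucat size_cat; apply: (leq_add s1 s2).
Qed.

Section FourRows.
Variable m : nat.
Hypotheses (m_gt0 : 0 < m) (m_odd : odd m) (m_ge3 : 3 <= m).

Local Notation G := (@HTG m 4 3).
Local Notation v := (vtx 3 m_gt0 (isT : 0 < 4)).

Lemma column_closed f x : two_factor G f ->
  (forall z, f (v x 1) z -> z \in [:: v x 0; v x 2]) ->
  (forall z, f (v x 3) z -> z \in [:: v x 0; v x 2]) ->
  forall y z, f y z -> y.1 == x :> nat -> z.1 == x :> nat.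
Proof.
move=> f2 n1 n3 y z fyz /eqP yx.
have xm : x < m by rewrite -yx.
have vx r : (v x r).1 = x :> nat by rewrite /= modn_small.
have [f10 f12] := two_factor_pair f2 n1.
have [f30 f32] := two_factor_pair f2 n3.
have [fs _ _] := f2.
have n13 : v x 1 != v x 3 by rewrite vtx_eqE // eqxx.
have n02 r : r \in [:: 0; 2] -> f (v x r) z -> z.1 == x :> nat.
  move=> r02 frz; have := @two_factor_third _ _ _ f2 (v x r) _ _ z n13 _ _ frz.
  rewrite ![f (v x r) _]fs; move: r02; rewrite !inE => /orP[]/eqP->.
    by move=> /(_ f10 f30)/orP[]/eqP->; rewrite vx.
  by move=> /(_ f12 f32)/orP[]/eqP->; rewrite vx.
move: fyz; rewrite -[y](vtxK 3 m_gt0 (isT : 0 < 4)) yx.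
case: y.2 => [[|[|[|[|r]]]] //= _]; [exact: n02 | | exact: n02 |].
  by move=> /n1; rewrite !inE => /orP[]/eqP->; rewrite vx.
by move=> /n3; rewrite !inE => /orP[]/eqP->; rewrite vx.
Qed.

(* Two vertices joined by a flat edge cannot be separated: the four vertices of
   either column would lie on one side, so that both columns are components,
   and a third column is left over. *)
Lemma four_rows_not_two_spanning_cyclable : ~ two_spanning_cyclable G.
Proof.
move=> cyc.
have [|f [c1 [c2 [f2 fc v1 v2]]]] := cyc (v 0 1) (v 1 1).
  by rewrite vtx_eqE // ltnW.
have [fs fe _] := f2; have [[/andP[cy1 _] _] [/andP[cy2 _] _] dis _] := fc.
have mono := two_cycles_mono fc.
have v2' : (v 1 1 \in c1) = false by rewrite (disjointFl dis v2).
have n_even : ~~ odd 4 by [].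
have odd_m : odd m = odd 3 by rewrite m_odd.
have v4 x : v x 4 = v x 0 by apply: (vtxDn 3 m_gt0 _ x 0).
have v6 x : v x 6 = v x 2 by apply: (vtxDn 3 m_gt0 _ x 2).
have adj0 r y : r \in [:: 1; 3] -> G (v 0 r) y ->
    y \in [:: v 0 0; v 0 2; v 1 r].
  move=> r13 /(HTG_adjP n_even odd_m); move: r13; rewrite !inE => /orP[]/eqP->.
    by case=> /= ->; rewrite ?v4 eqxx ?orbT.
  by case=> /= ->; rewrite ?v4 ?v6 eqxx ?orbT.
have adj1 r y : r \in [:: 1; 3] -> G (v 1 r) y ->
    y \in [:: v 1 0; v 1 2; v 0 r].
  move=> r13 /(HTG_adjP n_even odd_m).
  rewrite -(vtx_left 3 m_gt0 (isT : 0 < 4) 0 r).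
  move: r13; rewrite !inE => /orP[]/eqP->.
    by case=> ->; rewrite ?v4 eqxx ?orbT.
  by case=> ->; rewrite ?v4 ?v6 eqxx ?orbT.
have drop r x x' : (forall y, G (v x r) y -> y \in [:: v x 0; v x 2; v x' r]) ->
    (v x r \in c1) != (v x' r \in c1) ->
    forall y, f (v x r) y -> y \in [:: v x 0; v x 2].
  move=> adj ne y fy; have := adj _ (fe _ _ fy); rewrite !inE.
  case/or3P => [->|->|/eqP Ey]; rewrite ?orbT //.
  by move/mono: fy ne; rewrite Ey => ->; rewrite eqxx.
have row3 x x' b :
    (forall r y, r \in [:: 1; 3] -> G (v x r) y ->
       y \in [:: v x 0; v x 2; v x' r]) ->
    (v x 1 \in c1) = b -> (v x' 1 \in c1) = ~~ b ->
    (v x 3 \in c1) = b.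
  move=> adj xb x'b; have d1 := drop 1 x x' (fun y => adj 1 y isT).
  have [|/mono e0 /mono e2] := two_factor_pair f2 (d1 _).
    by rewrite xb x'b; case: (b).
  apply/eqP; apply: contraT; rewrite -xb => ne.
  have [_ /mono E] : f (v x 3) (v x' 3) /\ f (v x 3) (v x 0).
    apply: (two_factor_pair f2) => y fy; have := adj 3 y isT (fe _ _ fy).
    rewrite !inE => /or3P[->|/eqP Ey|->]; rewrite ?orbT //.
    by move/mono: fy ne; rewrite Ey -e2 => ->; rewrite eqxx.
  by move: ne; rewrite E e0 eqxx.
have c03 := row3 0 1 true adj0 v1 v2'.
have c13 := row3 1 0 false adj1 v2' v1.
have cl0 : forall y z, f y z -> y.1 == 0 :> nat -> z.1 == 0 :> nat.
  apply: (column_closed f2).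
    by apply: (drop 1 0 1) => [y|]; [apply: adj0 | rewrite v1 v2'].
  by apply: (drop 3 0 1) => [y|]; [apply: adj0 | rewrite c03 c13].
have cl1 : forall y z, f y z -> y.1 == 1 :> nat -> z.1 == 1 :> nat.
  apply: (column_closed f2).
    by apply: (drop 1 1 0) => [y|]; [apply: adj1 | rewrite v1 v2'].
  by apply: (drop 3 1 0) => [y|]; [apply: adj1 | rewrite c03 c13].
pose S k (y : 'I_m * 'I_4) := y.1 == k :> nat.
have v20 k : k < 2 -> ~~ S k (v 2 0).
  by rewrite /S /= modn_small //; case: k => [|[]].
have /orP[in_c|in_c] := two_cycles_cover f2 fc (v 2 0).
  have S00 : S 0 (v 0 1) by rewrite /S /= mod0n.
  have := cycle_closed cy1 cl0 v1 S00 in_c.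
  exact/negP/v20.
have S11 : S 1 (v 1 1) by rewrite /S /= modn_small // ltnW.
have := cycle_closed cy2 cl1 v2 S11 in_c.
exact/negP/v20.
Qed.

End FourRows.

Section Pappus.

Local Notation G := (@HTG 3 6 3).
Local Notation v := (vtx 3 (isT : 0 < 3) (isT : 0 < 6)).

(* Vertices of HTG(3, 6, 3) are coded by the numbers below 18. A 2-factor is
   given by the list [s] whose entry [a] is the neighbour of [a] missing from
   it, that is, by the complementary perfect matching. *)
Definition pcode x y := 6 * (x %% 3) + (y + 3 * (x %/ 3)) %% 6.

Definition pnbrs a :=
  let x := a %/ 6 in let y := a %% 6 in
  [:: pcode x y.+1; pcode x (y + 5);
      if odd (x + y) then pcode x.+1 y else pcode (x + 2) (y + 15)].

Definition consistent (s : seq nat) b :=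
  all (fun i => (nth 0 s i == size s) ==> (b == i)) (iota 0 (size s))
  && ((b < size s) ==> (nth 0 s b == size s)).

Fixpoint matchings k : seq (seq nat) :=
  if k is k'.+1 then
    [seq rcons s b | s <- matchings k',
                     b <- [seq b <- pnbrs k' | consistent s b]]
  else [:: [::]].

Definition fnbrs s a := [seq b <- pnbrs a | b != nth 0 s a].

Definition reach s a :=
  iter 9 (fun r => undup (r ++ flatten (map (fnbrs s) r))) [:: a].

Definition fclosed s r := all (fun b => all (mem r) (fnbrs s b)) r.

Definition not_separating s :=
  let r0 := reach s 0 in let r1 := reach s 1 in
  (1 \in r0) ||
  [&& fclosed s r0, fclosed s r1 &
      has (fun w => (w \notin r0) && (w \notin r1)) (iota 0 18)].

Lemma matchings_not_separating : all not_separating (matchings 18).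
Proof. by vm_compute. Qed.

Lemma reach_refl s a : a \in reach s a.
Proof.
rewrite /reach; elim: (X in iter X) => [|k IH]; first by rewrite inE.
by rewrite iterS mem_undup mem_cat IH.
Qed.

Lemma reach_ind s (P : nat -> Prop) a : P a ->
  (forall b c, P b -> c \in fnbrs s b -> P c) ->
  forall b, b \in reach s a -> P b.
Proof.
move=> Pa step; rewrite /reach; elim: (X in iter X) => [|k IH] b.
  by rewrite inE => /eqP->.
rewrite iterS mem_undup mem_cat => /orP[/IH//|/flatten_mapP[c /IH Pc]].
exact: step.
Qed.

#[local] Opaque reach.

Definition pvtx a := v (a %/ 6) (a %% 6).

Lemma pcodeK x y : pvtx (pcode x y) = v x y.
Proof.
rewrite /pvtx /pcode mulnC divnMDl // modnMDl modn_mod divn_small ?ltn_pmod //.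
rewrite addn0; congr pair; apply: val_inj => /=; first by rewrite modn_mod.
by rewrite [_ %% 3 %/ 3]divn_small ?ltn_pmod // muln0 addn0 modn_mod.
Qed.

Lemma pvtx_inj a b : a < 18 -> b < 18 -> pvtx a = pvtx b -> a = b.
Proof.
move=> a18 b18 /eqP; rewrite /pvtx vtx_eqE ?ltn_pmod ?ltn_divLR //.
by case/andP=> /eqP E1 /eqP E2; rewrite (divn_eq a 6) E1 E2 -divn_eq.
Qed.

Lemma pnbrs_props a : a < 18 ->
  [/\ uniq (pnbrs a), size (pnbrs a) = 3 &
      forall b, b \in pnbrs a -> b < 18 /\ a \in pnbrs b].
Proof.
have /allP H : all (fun a => uniq (pnbrs a) &&
    all (fun b => (b < 18) && (a \in pnbrs b)) (pnbrs a)) (iota 0 18).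
  by vm_compute.
move=> a18; have /andP[U /allP H2] := H a ltac:(by rewrite mem_iota).
by split=> // b /H2/andP[].
Qed.

Lemma pnbrs_adj a w : G (pvtx a) w -> w \in map pvtx (pnbrs a).
Proof.
by case/HTG_adjP => // ->; rewrite /= !pcodeK !inE ?eqxx ?orbT //; case: ifP;
  rewrite !pcodeK eqxx !orbT.
Qed.

Lemma HTG_3_6_not_two_spanning_cyclable : ~ two_spanning_cyclable G.
Proof.
move=> cyc.
have [|f [c1 [c2 [f2 fc v0 v1]]]] := cyc (pvtx 0) (pvtx 1).
  by apply/eqP => /(@pvtx_inj 0 1 isT isT).
have [fs fe _] := f2; have [[/andP[cy1 _] _] [/andP[cy2 _] _] dis _] := fc.
have mono := two_cycles_mono fc.
pose F a b := f (pvtx a) (pvtx b).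
pose mate a := head 0 [seq b <- pnbrs a | ~~ F a b].
have mateP a : a < 18 -> mate a \in pnbrs a /\
    forall b, b \in pnbrs a -> F a b = (b != mate a).
  move=> a18; have [U s3 nb] := pnbrs_props a18.
  have adj := @pnbrs_adj a; rewrite /mate.
  case: (pnbrs a) U s3 nb adj => [|b0 [|b1 [|b2 [|]]]] // U _ nb adj.
  have Ud : uniq (map pvtx [:: b0; b1; b2]).
    rewrite map_inj_in_uniq // => x y /nb[x18 _] /nb[y18 _].
    exact: pvtx_inj.
  have := two_factor_count f2 Ud adj; rewrite /= -!/(F _ _).
  move: U; rewrite /= !inE negb_or => /and3P[/andP[n01 n02] n12 _].
  case E0: (F a b0); case E1: (F a b1); case E2: (F a b2) => //= _.
  - split=> [|b]; rewrite ?eqxx ?orbT // !inE => /or3P[]/eqP->;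
    by rewrite ?E0 ?E1 ?E2 ?n02 ?n12 ?eqxx.
  - split=> [|b]; rewrite ?eqxx ?orbT // !inE => /or3P[]/eqP->;
    by rewrite ?E0 ?E1 ?E2 ?n01 ?eqxx // eq_sym n12.
  split=> [|b]; rewrite ?eqxx ?orbT // !inE => /or3P[]/eqP->;
  by rewrite ?E0 ?E1 ?E2 ?eqxx // eq_sym ?n01 ?n02.
have mateK a : a < 18 -> mate (mate a) = a.
  move=> a18; have [ma Fa] := mateP a a18.
  have [_ _ /(_ _ ma)[m18 am]] := pnbrs_props a18.
  have [_ /(_ a am)] := mateP _ m18.
  rewrite /F fs -/(F _ _) Fa // eqxx => /esym/negbFE/eqP <-.
  by [].
pose s := map mate (iota 0 18).
have nths k a : a < k -> nth 0 (map mate (iota 0 k)) a = mate a.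
  by move=> ak; rewrite (nth_map 0) ?size_iota // nth_iota.
have s_match : s \in matchings 18.
  rewrite /s; have : 18 <= 18 by []; elim: {-2}18 => // k IH k18.
  have -> : iota 0 k.+1 = rcons (iota 0 k) k by rewrite -addn1 iotaD cats1.
  rewrite map_rcons; apply/allpairsPdep; exists (map mate (iota 0 k)), (mate k).
  split=> //; first exact/IH/ltnW.
  rewrite mem_filter (mateP _ k18).1 andbT /consistent size_map size_iota.
  apply/andP; split; last by apply/implyP => /nths ->; rewrite mateK.
  apply/allP => i; rewrite mem_iota /= => ik; rewrite nths //.
  by apply/implyP => /eqP <-; rewrite mateK // (ltn_trans ik).
have fnbrsP a b : a < 18 -> (b \in fnbrs s a) = (b \in pnbrs a) && F a b.
  move=> a18; rewrite mem_filter nths // andbC.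
  by case: (boolP (b \in _)) => //= bn; rewrite (mateP a a18).2.
have reachP a b : a < 18 -> b \in reach s a ->
    b < 18 /\ (pvtx b \in c1) = (pvtx a \in c1).
  move=> a18; move: b; apply: reach_ind => // b c [b18 <-].
  rewrite fnbrsP // => /andP[bc /mono->].
  by have [_ _ /(_ c bc)[]] := pnbrs_props b18.
have closedP a : a < 18 -> fclosed s (reach s a) -> forall y z, f y z ->
    y \in map pvtx (reach s a) -> z \in map pvtx (reach s a).
  move=> a18 /allP clo y z fyz /mapP[b br Ey]; rewrite Ey in fyz.
  have /mapP[c cb Ez] := pnbrs_adj (fe _ _ fyz).
  rewrite Ez; apply: map_f; have /allP := clo b br; apply.
  by rewrite fnbrsP ?cb /F -?Ez //; have [] := reachP a b a18 br.
have := allP matchings_not_separating s s_match.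
rewrite /not_separating; cbv zeta; case/orP.
  by move=> /(reachP 0 1 isT)[_]; rewrite v0 (disjointFl dis v1).
case/and3P=> cl0 cl1 /hasP[w]; rewrite mem_iota /= => w18 /andP[w0 w1].
pose S a : pred ('I_3 * 'I_6) := fun y => y \in map pvtx (reach s a).
have notS a : a < 18 -> w \notin reach s a -> ~~ S a (pvtx w).
  move=> a18; apply: contra => /mapP[b br /(pvtx_inj w18)->] //.
  by have [] := reachP a b a18 br.
have S0 : S 0 (pvtx 0) by apply/map_f/reach_refl.
have S1 : S 1 (pvtx 1) by apply/map_f/reach_refl.
have /orP[wc|wc] := two_cycles_cover f2 fc (pvtx w).
  have := cycle_closed (S := S 0) cy1 (closedP 0 isT cl0) v0 S0 wc.
  exact/negP/notS.
have := cycle_closed (S := S 1) cy2 (closedP 1 isT cl1) v1 S1 wc.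
exact/negP/notS.
Qed.

End Pappus.

Theorem theorem4p2 (m n : nat) (m_ge1 : 1 <= m) (m_odd : odd m)
    (n_ge4 : 4 <= n) (n_even : ~~ odd n) :
  two_spanning_cyclable (@HTG m n 3) <->
  [\/ [/\ m = 1, n = 0 %[mod 4] & 6 < n],
      5 <= m /\ n = 6
    | 3 <= m /\ 8 <= n].
Proof.
have n_gt0 : 0 < n by apply: leq_trans n_ge4.
have m13 : m = 1 \/ 3 <= m by lia.
split=> [cyc|[[m1 n4 n6]|[m5 n6]|[m3 n8]]].
- have [n4|n6] : n = 4 \/ 6 <= n by lia.
    case: m13 => [m1|m3]; subst n.
      have := cyc (vtx 3 m_ge1 n_gt0 0 0) (vtx 3 m_ge1 n_gt0 0 1).
      rewrite vtx_eqE // => /(_ isT)/separable_card.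
      by rewrite card_prod !card_ord m1.
    by case: (four_rows_not_two_spanning_cyclable m_ge1 m_odd m3 cyc).
  case: m13 => [m1|m3].
    subst m; have [odd_k|even_k] := boolP (odd n./2).
      by case: (moebius_not_two_spanning_cyclable n_gt0 n_even odd_k n6 cyc).
    by constructor 1; split=> //; lia.
  have [n8|n_lt8] := leqP 8 n; first by constructor 3.
  have En : n = 6 by lia.
  constructor 2; split=> //; rewrite ltnNge; apply/negP => m4.
  have Em : m = 3 by lia.
  by subst m n; apply: HTG_3_6_not_two_spanning_cyclable cyc.
- subst m; apply: (prism_two_spanning_cyclable n_gt0) => //; last by lia.
  by rewrite /dvdn n4.
- by apply: HTG3_two_spanning_cyclable; rewrite // n6.
have [m5|m_lt5] := leqP 5 m.
  by apply: HTG3_two_spanning_cyclable => //; apply: leq_trans n8.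
have Em : m = 3 by lia.
by subst m; apply: HTG3_3_two_spanning_cyclable.
Qed.
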